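(* Let $k \geq 2$ be an integer, let $t \geq 0$, and let $P \in \mathscr{A}$ be a self-adjoint projection freely independent from $\{U_t, U_t^{\star}\}_{t \geq 0}$ with $\tau(P) = 1/k$. Then the distribution of $PU_tP$ in the compressed space $(P\mathscr{A}P, k\tau)$ coincides with the distribution of $G_t^k/k$ in $(\mathscr{A}, \tau)$, where $G_t^k = U_t^1 + \dots + U_t^k$.
   Context: $(\mathscr{A},\tau)$ is a tracial non commutative probability space (a von Neumann algebra with faithful normal tracial state $\tau$). $(U_t)_{t\ge 0}$ is a free unitary Brownian motion in $\mathscr{A}$, i.e. the solution of the free stochastic differential equation $dU_t = iU_t\,dX_t - \frac{1}{2}U_t\,dt$, $U_0 = {\bf 1}$, where $(X_t)_{t \ge 0}$ is a free additive Brownian motion. $(U_t^j)_{t\ge0}$, $1\le j\le k$, are $k$ $\star$-free copies of $(U_t)_{t \ge 0}$ in $(\mathscr{A},\tau)$. The distribution of an operator $a$ in a non commutative probability space means the joint distribution of $(a,a^{\star})$, i.e. the collection of all $\star$-moments of $a$. The compressed space $P\mathscr{A}P$ has unit $P$ and is equipped with the tracial state $\tau/\tau(P) = k\tau$. *)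

(* Defs.v *)
From HB Require Import structures.
From mathcomp Require Import all_boot all_order all_algebra.
From mathcomp Require Import complex.
From mathcomp Require Import all_classical all_reals all_analysis.

Set Implicit Arguments.
Unset Strict Implicit.
Unset Printing Implicit Defensive.

Import Order.TTheory GRing.Theory Num.Theory.
Import numFieldNormedType.Exports.

Local Open Scope classical_set_scope.
Local Open Scope complex_scope.
Local Open Scope ring_scope.

Record hilbertSpace (R : realType) := HilbertSpace {
  hilb_sort :> completeNormedModType R[i];
  hilb_dot : {dot hilb_sort for @Num.conj R[i]};
  hilb_normE : forall x : hilb_sort, `|x| ^+ 2 = hilb_dot x x }.

Definition bounded_operator (R : realType) (H : hilbertSpace R) (T : H -> H) :=
  linear T /\ continuous T.

Definition commutant (R : realType) (H : hilbertSpace R) (S : set (H -> H)) :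
    set (H -> H) :=
  [set T | bounded_operator T /\ forall s, S s -> T \o s = s \o T].

(* The order of a C*-algebra: [a <= b] iff [b - a] is positive. *)
Definition star_le (R : realType) (A : algType R[i]) (star : A -> A) (a b : A) :=
  exists c : A, b - a = star c * c.

(* A von Neumann algebra, given with a faithful unital representation [rep] as
   a self-adjoint algebra of operators equal to its bicommutant, together with
   a faithful normal tracial state [tau].  Normality is order continuity along
   upward directed families of self-adjoint elements; as [tau] is monotone,
   only one half of "[tau s] is the supremum of [tau @` D]" is required. *)
Record tracialSpace (R : realType) := TracialSpace {
  ts_alg :> algType R[i];
  star : ts_alg -> ts_alg;
  starK : involutive star;
  starD : forall a b, star (a + b) = star a + star b;
  starZ : forall (c : R[i]) a, star (c *: a) = c^* *: star a;
  starM : forall a b, star (a * b) = star b * star a;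
  ts_hilb : hilbertSpace R;
  rep : ts_alg -> ts_hilb -> ts_hilb;
  rep_bounded : forall a, bounded_operator (rep a);
  rep_linear : forall (c : R[i]) a b x,
    rep (c *: a + b) x = c *: rep a x + rep b x;
  rep1 : forall x, rep 1 x = x;
  repM : forall a b x, rep (a * b) x = rep a (rep b x);
  rep_star : forall a x y,
    hilb_dot ts_hilb (rep (star a) x) y = hilb_dot ts_hilb x (rep a y);
  rep_inj : injective rep;
  rep_bicommutant : commutant (commutant (range rep)) = range rep;
  tau : {scalar ts_alg};
  tau1 : tau 1 = 1;
  tau_ge0 : forall a, 0 <= tau (star a * a);
  tau_faithful : forall a, tau (star a * a) = 0 -> a = 0;
  tau_tracial : forall a b, tau (a * b) = tau (b * a);
  tau_normal : forall (D : set ts_alg) (s : ts_alg),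
    D !=set0 ->
    (forall d, D d -> star d = d) ->
    (forall d1 d2, D d1 -> D d2 ->
       exists d, [/\ D d, star_le star d1 d & star_le star d2 d]) ->
    (forall d, D d -> star_le star d s) ->
    (forall u, star u = u -> (forall d, D d -> star_le star d u) ->
       star_le star s u) ->
    forall c : R[i], (forall d, D d -> tau d <= c) -> tau s <= c }.

Section TracialSpace.
Variables (R : realType) (A : tracialSpace R).
Implicit Types (a : A) (S : set A) (X U V : R -> A).

Definition unital_star_subalgebra (B : set A) :=
  [/\ B 1, forall (c : R[i]) a b, B a -> B b -> B (c *: a + b),
      forall a b, B a -> B b -> B (a * b) & forall a, B a -> B (star a)].

Definition star_algebra_gen S : set A := smallest unital_star_subalgebra S.

(* Von Neumann's bicommutant of the self-adjoint set S `|` S^*. *)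
Definition vN_gen S : set A :=
  [set a | commutant (commutant (@rep R A @` (S `|` (@star R A @` S)))) (rep a)].

(* Freeness of the unital *-algebras generated by the sets [S i]: alternating
   products of centered elements are centered. *)
Definition star_free (I : Type) (S : I -> set A) :=
  forall (n : nat) (i : nat -> I) (a : nat -> A), (0 < n)%N ->
    (forall j, (j < n)%N -> star_algebra_gen (S (i j)) (a j) /\ tau A (a j) = 0) ->
    (forall j, (j.+1 < n)%N -> i j <> i j.+1) ->
    tau A (\prod_(j < n) a j) = 0.

Definition star_free2 (S T : set A) :=
  star_free (fun b : bool => if b then S else T).

Definition adj_if (b : bool) a := if b then star a else a.

(* The *-moments of [a] in the *-algebra [e A e] with unit [e] (a self-adjoint
   projection such that [e * a * e = a]) and state [phi]; [true] is the letter
   [star a], and the empty word is the unit. *)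
Definition star_distribution (e : A) (phi : A -> R[i]) a (w : seq bool) : R[i] :=
  phi (foldr (fun b y => adj_if b a * y) e w).

Definition process_set U : set A := [set U t | t in [set t | 0 <= t]].

Definition process_moment U (w : seq (R * bool)) : R[i] :=
  tau A (\prod_(l <- w) adj_if l.2 (U l.1)).

(* Equality of the joint *-distributions of the processes indexed by [0, +oo[. *)
Definition process_copy U V :=
  forall w : seq (R * bool), (forall l, l \in w -> 0 <= l.1) ->
    process_moment V w = process_moment U w.

(* Semicircle law of mean 0 and variance v, for v > 0. *)
Definition semicircular (v : R) a :=
  star a = a /\
  forall n : nat, tau A (a ^+ n) =
    (\int[lebesgue_measure]_(x in `[- (2 * Num.sqrt v), 2 * Num.sqrt v]%classic)
       (x ^+ n * (Num.sqrt (4 * v - x ^+ 2) / (2 * pi * v))))%:C.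

Definition past X (s : R) : set A := vN_gen [set X u | u in [set u | 0 <= u <= s]].

Record free_brownian_motion X : Prop := FreeBrownianMotion {
  fbm0 : X 0 = 0;
  fbm_sa : forall t, 0 <= t -> star (X t) = X t;
  fbm_incr : forall s t, 0 <= s -> s < t -> semicircular (t - s) (X t - X s);
  fbm_free : forall s t, 0 <= s -> s < t -> star_free2 [set X t - X s] (past X s) }.

Definition norm2 a : R := Num.sqrt (complex.Re (tau A (star a * a))).

(* The step process equal to [sp_val j] on [sp_time j, sp_time j.+1[. *)
Record step_process := StepProcess {
  sp_size : nat;
  sp_time : nat -> R;
  sp_val : nat -> A }.

Definition adapted_step X (t : R) (h : step_process) :=
  [/\ sp_time h 0%N = 0, sp_time h (sp_size h) = t,
      forall j, (j < sp_size h)%N -> sp_time h j <= sp_time h j.+1 &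
      forall j, (j < sp_size h)%N -> past X (sp_time h j) (sp_val h j)].

Definition step_at (h : step_process) (s : R) : A :=
  \sum_(j < sp_size h | sp_time h j <= s < sp_time h j.+1) sp_val h j.

Definition step_integral (h : step_process) (Z : R -> A) : A :=
  \sum_(j < sp_size h) sp_val h j * (Z (sp_time h j.+1) - Z (sp_time h j)).

(* [K] is the integral of [U dZ] over [0, t]: the ||.||_2-limit of the integrals
   of X-adapted step processes converging to [U] in L^2([0, t]; L^2(A, tau)).
   For [Z = X] this is the free Ito integral; for [Z s = s 1] it is the
   Bochner integral of [U_s ds]. *)
Definition is_integral X U (Z : R -> A) (t : R) (K : A) :=
  exists h : nat -> step_process,
    [/\ forall n, adapted_step X t (h n),
        (fun n => (\int[lebesgue_measure]_(s in `[0%R, t]%classic)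
           ((norm2 (U s - step_at (h n) s)%R) ^+ 2)%:E)%E) @ \oo --> 0%E &
        (fun n => norm2 (step_integral (h n) Z - K)) @ \oo --> (0 : R)].

(* [U] solves [dU = i U dX - U/2 dt] with [U 0 = 1], as an adapted process that
   is continuous for the norm ||.||_2. *)
Record free_unitary_brownian_motion X U : Prop := FreeUnitaryBrownianMotion {
  fubm_driver : free_brownian_motion X;
  fubm_adapted : forall t, 0 <= t -> past X t (U t);
  fubm_continuous : forall s, 0 <= s ->
    norm2 (U r - U s) @[r --> within [set r | 0 <= r] (nbhs s)] --> (0 : R);
  fubm0 : U 0 = 1;
  fubm_sde : forall t, 0 <= t -> exists I J : A,
    [/\ is_integral X U X t I,
        is_integral X U (fun s => s%:C *: 1) t J &
        U t = 1 + 'i *: I - 2^-1 *: J] }.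

End TracialSpace.

(* Main.v *)
Require Import Defs.
From mathcomp Require Import all_boot all_order all_algebra.
From mathcomp Require Import complex.
From mathcomp Require Import all_classical all_reals all_analysis.
From mathcomp Require Import ring.

Import GRing.Theory Num.Theory.
Local Open Scope classical_set_scope.
Local Open Scope complex_scope.
Local Open Scope ring_scope.

Set Implicit Arguments.
Unset Strict Implicit.
Unset Printing Implicit Defensive.

(* Only freeness matters: the result is the free compression formula of Nica and
   Speicher, valid for any element a in place of U t.  If kap is the free
   cumulant functional of (a, a^star), both sides have the cumulants
   w |-> k * k^-|w| * kap w: on the left each gap between consecutive letters
   of a block carries P, whose trace is k^-1; on the right the k free copies of
   a / k add their cumulants, mixed ones being zero.

   Noncrossing partitions are handled by a stack: a word is read from left to
   right, and each letter is either pushed or closes a block formed with the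
   topmost letters of the stack, at the cost kap of that block.  Each reading
   step is a linear operator on functions of the stack, and the moment of a word
   is the value at the empty stack of the product of its operators applied to
   the indicator of the empty stack.  For several colors, with vanishing mixed
   cumulants, these operators satisfy freeness, and free moments are determined
   by the moments of the one-colored words.  Summing over the colors of the
   stack, resp. inserting P below each of its letters, turns the stack model of
   the free copies, resp. of (a, P), into the one-color model with the cumulants
   above. *)

(** * Free moments are determined by the one-colored words *)

Section FreeMoments.
Variables (C : comNzRingType) (I : eqType) (L : Type) (col : L -> I).
Implicit Types (f g : seq L -> C) (u w : seq L) (us : seq (seq L)).

(* The moment of [w * \prod_(u <- us) (u - f u)]. *)
Fixpoint centered f w us : C :=
  if us is u :: us' then centered f (w ++ u) us' - f u * centered f w us'
  else f w.

Definition colored (i : I) (w : seq L) := all (fun x => col x == i) w.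

Definition alternating (bs : seq (I * seq L)) :=
  all (fun b => ~~ nilp b.2 && colored b.1 b.2) bs &&
  sorted (fun b b' => b.1 != b'.1) bs.

Definition free_moments f := forall b bs,
  alternating (b :: bs) -> centered f [::] (map snd (b :: bs)) = 0.

Lemma alternating_flatten w :
  exists2 bs, alternating bs & w = flatten (map snd bs).
Proof.
elim: w => [|x w [bs bsP ->]]; first by exists [::].
case: bs bsP => [|[i u] bs].
  by exists [:: (col x, [:: x])]; rewrite // /alternating /= eqxx.
rewrite /alternating /= => /andP[/andP[/andP[u0 ui] bsP] bsS].
have [xi|xi] := eqVneq (col x) i.
  by exists ((i, x :: u) :: bs); rewrite // /alternating /= xi eqxx ui bsP; case: (bs) bsS.
exists ((col x, [:: x]) :: (i, u) :: bs) => //.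
by rewrite /alternating /= eqxx u0 ui bsP xi bsS.
Qed.

(** Expanding the centered product, every term other than the full word drops some nonempty factor,
    so it only involves values at the factors and at words shorter than [n]. *)
Lemma centered_diff f g n us w :
    (forall v, (size v < n)%N -> f v = g v) ->
    all (fun u => ~~ nilp u) us -> (forall i, f (nth [::] us i) = g (nth [::] us i)) ->
    (size w + size (flatten us) <= n)%N ->
  centered f w us - f (w ++ flatten us) = centered g w us - g (w ++ flatten us).
Proof.
move=> fg; elim: us w => [|u us IH] w /=; first by rewrite cats0 !subrr.
case/andP=> u0 us0 fgus; rewrite size_cat => szw.
have fgus' i := fgus i.+1.
have u_gt0 : (0 < size u)%N by case: (u) u0.
have lt_n : (size w + size (flatten us) < n)%N.
  by apply: leq_trans szw; rewrite ltn_add2l -[ltnLHS]add0n ltn_add2r.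
have := IH w us0 fgus' (ltnW lt_n).
rewrite [f (w ++ _)]fg ?size_cat // => /addIr ->.
have := fgus 0%N; rewrite /= => ->.
rewrite addrAC catA IH ?size_cat -?addnA //.
by rewrite addrAC.
Qed.

(* Expanding the vanishing product of the centered maximal one-colored factors
   of a word expresses its value through shorter words. *)
Lemma free_moments_unique f g :
    free_moments f -> free_moments g ->
    f [::] = g [::] -> (forall i w, colored i w -> f w = g w) ->
  f =1 g.
Proof.
move=> f_free g_free fg0 fg w; have [n] := ubnP (size w).
elim: n w => // n IH w; rewrite ltnS => szw.
have [[|b bs] bsP ew] := alternating_flatten w.
  by rewrite ew.
have := @centered_diff f g n (map snd (b :: bs)) [::].
rewrite cat0s -ew f_free // g_free // !sub0r => /(_ _ _ _ _)/oppr_inj; apply=> //.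
- by rewrite all_map; move/andP: bsP => [+ _]; apply: sub_all => c /andP[].
- move=> i; have [lt_i|ge_i] := ltnP i (size (b :: bs)).
    move/andP: bsP => [/(all_nthP b)/(_ _ lt_i)/andP[_ +] _].
    by rewrite (nth_map b) //; exact: fg.
  by rewrite nth_default ?size_map //; exact: (fg b.1).
Qed.

End FreeMoments.

(** * Stack model of the moment-cumulant formula *)

Definition run (M F : Type) (op : M -> F -> F) (w : seq M) (f : F) :=
  foldr op f w.

Lemma run_cat (M F : Type) (op : M -> F -> F) u w f :
  run op (u ++ w) f = run op u (run op w f).
Proof. exact: foldr_cat. Qed.

Section StackModel.
Variables (C : comNzRingType) (L : Type).
Implicit Types (kap : seq L -> C) (f g : seq L -> C) (s t u w ys : seq L).

Definition vacuum (s : seq L) : C := (nilp s)%:R.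

(* The letters [ys], in order of reading, are those of a block being closed; it
   may be extended by the letters on top of the stack. *)
Fixpoint pop kap f ys s : C :=
  kap ys * f s + (if s is y :: s' then pop kap f (y :: ys) s' else 0).

Definition read kap x f s : C := f (x :: s) + pop kap f [:: x] s.



Lemma pop_vacuum kap ys s : pop kap vacuum ys s = kap (catrev s ys).
Proof.
elim: s ys => [|y s IH] ys /=; first by rewrite mulr1 addr0.
by rewrite mulr0 add0r IH.
Qed.

Lemma eq_pop kap1 kap2 f1 f2 n ys s :
    (forall w, (size w <= n)%N -> kap1 w = kap2 w) ->
    (forall s', (size s' <= size s)%N -> f1 s' = f2 s') ->
    (size s + size ys <= n)%N ->
  pop kap1 f1 ys s = pop kap2 f2 ys s.
Proof.
move=> ekap; elim: s ys => [|y s IH] ys ef szn /=.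
  by rewrite ekap // ef.
rewrite ekap ?(leq_trans _ szn) ?leq_addl // ef // IH //= ?addnS //.
by move=> s' szs'; apply: ef; rewrite (leq_trans szs') /=.
Qed.

Lemma eq_run_read kap1 kap2 s w :
    (forall v, (size v <= size s + size w)%N -> kap1 v = kap2 v) ->
  run (read kap1) w vacuum s = run (read kap2) w vacuum s.
Proof.
elim: w s => //= x w IH s ekap; rewrite /read IH /=; last first.
  by move=> v; rewrite addSnnS => /ekap.
congr (_ + _); apply: (eq_pop (n := (size s).+1)); rewrite ?addn1 //.
  by move=> v szv; apply: ekap; rewrite (leq_trans szv) // -addSnnS leq_addr.
move=> s' szs'; apply: IH => v szv; apply: ekap.
by rewrite (leq_trans szv) // leq_add.
Qed.

(** Only one block is longer than [size s + size w]: the one obtained by pushing all letters but the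
    last, which then closes a block with the entire stack. *)
Lemma run_read_diff kap1 kap2 s x w :
    (forall v, (size v <= size s + size w)%N -> kap1 v = kap2 v) ->
  run (read kap1) (x :: w) vacuum s - run (read kap2) (x :: w) vacuum s =
  kap1 (catrev s (x :: w)) - kap2 (catrev s (x :: w)).
Proof.
elim: w s x => [|y w IH] s x ekap.
  by rewrite /= /read !pop_vacuum /vacuum !add0r.
have ->: catrev s [:: x, y & w] = catrev (x :: s) (y :: w) by [].
rewrite -IH /=; last by move=> v; rewrite addSnnS => /ekap.
rewrite ![read _ x _ _]/(_ + _) -/run.
set c1 := pop kap1 _ _ _; set c2 := pop kap2 _ _ _.
suff -> : c1 = c2 by rewrite opprD addrACA subrr addr0.
apply: (eq_pop (n := (size s).+1)); rewrite ?addn1 //.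
  by move=> v szv; apply: ekap; rewrite (leq_trans szv) //= addnS ltnS leq_addr.
move=> s' szs'; apply: (@eq_run_read kap1 kap2 s' (y :: w)) => v szv.
by apply: ekap; rewrite (leq_trans szv) // leq_add2r.
Qed.

(* [kap w] occurs in the moment of [w] only in the term of the one-block
   partition, by [run_read_diff], so it is obtained by subtraction. *)
Fixpoint cumulant_upto (m : seq L -> C) n w : C :=
  if n is n'.+1 then
    cumulant_upto m n' w +
    (if size w == n then m w - run (read (cumulant_upto m n')) w vacuum [::] else 0)
  else 0.

Lemma cumulant_uptoE m n w :
  (size w <= n)%N -> cumulant_upto m n w = cumulant_upto m (size w) w.
Proof.
elim: n => [|n IH]; first by rewrite leqn0 => /eqP->.
rewrite leq_eqVlt => /predU1P[<- //|szw].
by rewrite /= ltn_eqF // addr0 IH.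
Qed.

Lemma cumulant_exists (m : seq L -> C) : m [::] = 1 ->
  exists kap, forall w, run (read kap) w vacuum [::] = m w.
Proof.
move=> m1; pose kap w := cumulant_upto m (size w) w; exists kap => -[//|x w].
set kapn := cumulant_upto m (size w).
have kapE : kap (x :: w) = kapn (x :: w) +
    (m (x :: w) - run (read kapn) (x :: w) vacuum [::]).
  by rewrite {1}/kap /= eqxx.
apply: (addIr (- run (read kapn) (x :: w) vacuum [::])).
rewrite run_read_diff => [|v szv]; last by rewrite /kapn [RHS]cumulant_uptoE.
by rewrite kapE [LHS]addrC addKr.
Qed.

Lemma pop_linear kap ys a f g s :
  pop kap (fun s => a * f s + g s) ys s =
  a * pop kap f ys s + pop kap g ys s.
Proof. by elim: s ys => [|y s IH] ys /=; [|rewrite IH]; ring. Qed.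

Lemma readZ kap x a f s : read kap x (fun s => a * f s) s = a * read kap x f s.
Proof.
rewrite /read mulrDr; congr (_ + _).
by elim: s [:: x] => [|y s IH] ys /=; [|rewrite IH]; ring.
Qed.

Lemma read_linear kap x a f g s :
  read kap x (fun s => a * f s + g s) s = a * read kap x f s + read kap x g s.
Proof. by rewrite /read pop_linear; ring. Qed.

End StackModel.

Lemma run_map (C : comNzRingType) (L L' : Type) (h : L -> L')
    (kap : seq L -> C) (kap' : seq L' -> C) (op : L' -> (seq L' -> C) -> seq L' -> C)
    (w s : seq L) :
    (forall x, op (h x) = read kap' (h x)) ->
    (forall ys, kap' (map h ys) = kap ys) ->
  run op (map h w) (@vacuum C L') (map h s) = run (read kap) w (@vacuum C L) s.
Proof.
move=> oph kaph; elim: w s => [|x w IH] s /=; first by rewrite /vacuum; case: s.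
rewrite oph /read (IH (x :: s)); congr (_ + _).
rewrite -/([seq h i | i <- [:: x]]).
elim: s [:: x] => [|y s IHs] ys /=; rewrite kaph.
  by rewrite (IH [::]).
by rewrite (IH (y :: s)) -(IHs (y :: ys)).
Qed.

(** * Freeness of stack operators *)

Section StackFreeness.
Variables (C : comNzRingType) (I : eqType) (L : Type) (col : L -> I).
Variable op : L -> (seq L -> C) -> seq L -> C.
Implicit Types (kap f g : seq L -> C) (s t u w : seq L).

Definition linear_op := forall x a f g s,
  op x (fun s => a * f s + g s) s = a * op x f s + op x g s.

Lemma run_linear (op_lin : linear_op) w a f g :
  run op w (fun s => a * f s + g s) = fun s => a * run op w f s + run op w g s.
Proof.
by elim: w => //= x w ->; apply/funext => s; rewrite op_lin.
Qed.

Definition top_colored (i : I) s := if s is y :: _ then col y == i else false.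

Lemma run_sum (op_lin : linear_op) (K : finType) w a (f : K -> seq L -> C) :
  run op w (fun s => a * \sum_i f i s) = fun s => a * \sum_i run op w (f i) s.
Proof.
(* [linear_op] only speaks of [a * f + g]; the value at zero comes from [a = -1]. *)
have run0 : run op w (fun=> 0) = fun=> 0.
  have := @run_linear op_lin w (-1) (fun=> 0) (fun=> 0).
  by rewrite mulr0 addr0 => {1}->; apply/funext => s; rewrite mulN1r addNr.
have sumE r : run op w (fun s => \sum_(i <- r) f i s) =
    fun s => \sum_(i <- r) run op w (f i) s.
  elim: r => [|i r IH].
    rewrite [in LHS](_ : (fun=> _) = fun=> 0) ?run0; last first.
      by apply/funext => s; rewrite big_nil.
    by apply/funext => s; rewrite big_nil.
  transitivity (run op w (fun s => 1 * f i s + \sum_(j <- r) f j s)).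
    by congr run; apply/funext => s; rewrite big_cons mul1r.
  by rewrite run_linear // IH; apply/funext => s; rewrite big_cons mul1r.
transitivity (run op w (fun s => a * (\sum_i f i s) + 0)).
  by congr run; apply/funext => s; rewrite addr0.
by rewrite run_linear // run0 sumE; apply/funext => s; rewrite addr0.
Qed.

(** Since [f] ignores stacks with top color [i], the letters of [u] have to cancel among themselves
    without touching [s], which yields their vacuum moment. *)
Definition free_op := forall i u f s, ~~ nilp u -> colored col i u ->
  (forall s, top_colored i s -> f s = 0) -> ~~ top_colored i s ->
  run op u f s = run op u (@vacuum C L) [::] * f s.

(* Running through the centered blocks from right to left produces a function
   supported on the stacks whose top has the color of the last block read. *)
Lemma free_op_moments : linear_op -> free_op ->
  free_moments col (fun w => run op w (@vacuum C L) [::]).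
Proof.
move=> op_lin op_free; set m := fun w => _.
pose cent us := foldr (fun u f s => - m u * f s + run op u f s) (@vacuum C L) us.
have centE w us : centered m w us = run op w (cent us) [::].
  elim: us w => //= u us IH w; rewrite !IH run_linear // run_cat.
  by rewrite mulNr addrC.
move=> b bs bsP; rewrite centE.
have step i u f s : ~~ nilp u -> colored col i u ->
    (forall s, top_colored i s -> f s = 0) -> ~~ top_colored i s ->
  - m u * f s + run op u f s = 0.
  by move=> *; rewrite (op_free i) // mulNr addNr.
suff : forall s, ~~ top_colored b.1 s -> cent (map snd (b :: bs)) s = 0 by apply.
elim: bs b bsP => [|b' bs IH] [i u] /andP[/= /andP[/andP[u0 ui] bsP] bsS] s si /=.
  by apply: (step i) => // -[|//].
apply: (step i) => // s' s'i; case/andP: bsS => ib' bsS.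
apply: IH; first by rewrite /alternating /= bsP.
by case: s' s'i => //= y s' /eqP->.
Qed.

Section ReadBlock.
Variables (kap : seq L -> C) (i : I).
Hypothesis kap_mixed : forall w,
  has (fun x => col x == i) w -> has (fun x => col x != i) w -> kap w = 0.

Lemma pop_mixed f ys s :
  has (fun x => col x == i) ys -> has (fun x => col x != i) ys ->
  pop kap f ys s = 0.
Proof.
elim: s ys => [|y s IH] ys ysi ysNi /=; rewrite kap_mixed // mul0r add0r //.
by rewrite IH //= ?ysi ?ysNi orbT.
Qed.

(** The block cannot grow into [s], whose top has another color, because mixed cumulants vanish. *)
Lemma pop_block f h c ys t s :
    (forall t', colored col i t' -> f (t' ++ s) = h t' * c) ->
    ~~ nilp ys -> colored col i ys -> colored col i t -> ~~ top_colored i s ->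
  pop kap f ys (t ++ s) = pop kap h ys t * c.
Proof.
move=> fh ys0 ysi ti si; elim: t ys ti ys0 ysi => [|y t IH] ys ti ys0 ysi.
  have := fh [::] isT; rewrite cat0s => /= fs.
  case: s si fs {fh} => [|y s] /= si ->; first by rewrite !addr0 mulrA.
  rewrite pop_mixed ?addr0 ?mulrA //= ?si //.
  by case: ys ys0 ysi => //= z ys _ /andP[->]; rewrite orbT.
case/andP: (ti) => yi ti'; rewrite /= -cat_cons fh // IH //= ?yi //.
by rewrite mulrDl mulrA.
Qed.

(** A leftover letter of color [i] above [s] kills both sides: the left one through [f], the right
    one through [vacuum]. *)
Lemma run_read_block u f s t :
    (forall x, col x = i -> op x = read kap x) ->
    colored col i u -> (forall s, top_colored i s -> f s = 0) ->
    colored col i t -> ~~ top_colored i s ->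
  run op u f (t ++ s) = run op u (@vacuum C L) t * f s.
Proof.
move=> opE ui f0 ti si; elim: u ui t ti => [|x u IH] /= ui t ti.
  case: t ti => [|y t] /= ti; first by rewrite /vacuum mul1r.
  by rewrite f0 ?mul0r //=; case/andP: ti.
case/andP: ui => xi ui; rewrite opE ?(eqP xi) // /read mulrDl -cat_cons IH //=.
  congr (_ + _); apply: pop_block => //=; last by rewrite xi.
  by move=> t' t'i; apply: IH.
by rewrite xi.
Qed.

End ReadBlock.
End StackFreeness.

(** * Sums of free copies: summing over the colors of the stack *)

Section SumModel.
Variables (C : comNzRingType) (J : finType) (B : Type) (kap : seq B -> C) (c : C).
Implicit Types (f g : seq (J * B) -> C) (t ys : seq B).

Definition joint_cumulant (w : seq (J * B)) : C :=
  if constant (map fst w) then kap (map snd w) else 0.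

Lemma joint_cumulant_mixed i w :
  has (fun x => x.1 == i) w -> has (fun x => x.1 != i) w ->
  joint_cumulant w = 0.
Proof.
move=> wi wNi; rewrite /joint_cumulant; case: w wi wNi => //= x w wi wNi.
rewrite all_map; case: ifP => // wx.
have xi : x.1 = i.
  case/orP: wi => [/eqP//|] {wNi}.
  by elim: w wx => //= y w IH /andP[/eqP yx wx] /orP[/eqP <-//|]; exact: IH.
by case/orP: wNi => [/eqP//|]; rewrite (has_predC (fun y => y.1 == i)) -xi => /negP[].
Qed.

Lemma joint_cumulant_pair j w : joint_cumulant (map (pair j) w) = kap w.
Proof.
rewrite /joint_cumulant (@mapK _ _ (pair j) snd) // ifT //.
by case: w => //= x w; elim: w => //= y w ->; rewrite eqxx.
Qed.

Definition sum_op b f (s : seq (J * B)) : C :=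
  c * \sum_j read joint_cumulant (j, b) f s.

Fixpoint sum_stack t g : C :=
  if t is b :: t' then c * \sum_j sum_stack t' (fun s => g ((j, b) :: s))
  else g [::].

Lemma sum_stack_sum (K : finType) t (g : K -> seq (J * B) -> C) a :
  sum_stack t (fun s => a * \sum_i g i s) = a * \sum_i sum_stack t (g i).
Proof.
elim: t g => //= b t IH g.
under eq_bigr do rewrite IH.
by rewrite -[in RHS]big_distrr /= -big_distrr /= exchange_big /= mulrCA.
Qed.

Lemma sum_stackD t f g :
  sum_stack t (fun s => f s + g s) = sum_stack t f + sum_stack t g.
Proof.
elim: t f g => //= b t IH f g; rewrite -mulrDr -big_split /=.
by under eq_bigr do rewrite IH.
Qed.

Lemma sum_stackZ t a f : sum_stack t (fun s => a * f s) = a * sum_stack t f.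
Proof.
elim: t f => //= b t IH f; under eq_bigr do rewrite IH.
by rewrite -big_distrr mulrCA.
Qed.

Lemma sum_stack0 t f : (forall s, f s = 0) -> sum_stack t f = 0.
Proof.
elim: t f => [|b t IH] f f0 /=; first exact: f0.
by rewrite big1 ?mulr0 // => j _; rewrite IH.
Qed.

Definition scaled_cumulant (N : C) (w : seq B) : C := N * c ^+ size w * kap w.

(** All letters of a block must share one color. Each letter brings its factor [c], and the common
    color remains free, whence [#|J|]. *)
Lemma sum_stack_pop t ys g : ~~ nilp ys ->
  c ^+ size ys *
    \sum_j sum_stack t (pop joint_cumulant g (map (pair j) ys)) =
  pop (scaled_cumulant #|J|%:R) (fun t => sum_stack t g) ys t.
Proof.
elim: t ys => [|b t IH] ys ys0 /=.
  rewrite addr0 (eq_bigr (fun=> kap ys * g [::])).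
    by rewrite sumr_const -mulr_natl /scaled_cumulant; ring.
  by move=> j _; case: (ys) ys0 => //= y ys' _; rewrite addr0 -(joint_cumulant_pair j).
rewrite -IH //= exprS /=.
(* Either the block closes before [(i, b)], or it absorbs it, and then only [i = j] survives. *)
have E j : c * \sum_i sum_stack t (fun s =>
     pop joint_cumulant g (map (pair j) ys) ((i, b) :: s)) =
   kap ys * (c * \sum_i sum_stack t (fun s => g ((i, b) :: s))) +
   c * sum_stack t (pop joint_cumulant g (map (pair j) (b :: ys))).
  rewrite [RHS]addrC mulrCA -mulrDr; congr (_ * _).
  rewrite big_distrr /= addrC.
  under eq_bigr do rewrite sum_stackD sum_stackZ joint_cumulant_pair.
  rewrite big_split; congr (_ + _); rewrite (bigD1 j) //= big1 ?addr0 // => i ij.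
  apply: sum_stack0 => s.
  apply: (pop_mixed (col := fst) (i := j) (joint_cumulant_mixed (i := j))).
    by case: (ys) ys0 => //= y ys' _; rewrite eqxx orbT.
  by rewrite /= ij.
under eq_bigr do rewrite E.
by rewrite big_split /= sumr_const -big_distrr /= -mulr_natl /scaled_cumulant; ring.
Qed.

Lemma sum_stack_op t b g :
  sum_stack t (sum_op b g) =
  read (scaled_cumulant #|J|%:R) b (fun t => sum_stack t g) t.
Proof.
rewrite sum_stack_sum /read -sum_stack_pop //= expr1 -mulrDr -big_split /=.
by under eq_bigr do rewrite sum_stackD.
Qed.

Lemma sum_stack_run t w :
  sum_stack t (run sum_op w (@vacuum C _)) =
  run (read (scaled_cumulant #|J|%:R)) w (@vacuum C _) t.
Proof.
elim: w t => [|b w IH] t /=.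
  case: t => [|b t] //=; rewrite big1 ?mulr0 // => j _; exact: sum_stack0.
by rewrite sum_stack_op; congr read; apply/funext => s.
Qed.

End SumModel.

(** * Compression by a free projection *)

Section CompressionModel.
Variables (C : comNzRingType) (B : Type) (kap : seq B -> C) (c : C).
Implicit Types (f g : seq (option B) -> C) (s w : seq (option B)) (t ys : seq B).

(** A block never contains [None]: the powers of P are left to [proj_op] instead of being expanded
    in cumulants. *)
Definition option_cumulant w : C :=
  if all isSome w then kap (pmap id w) else 0.

Lemma option_cumulant_map ys : option_cumulant (map Some ys) = kap ys.
Proof. by rewrite /option_cumulant all_map all_predT (@map_pK _ _ id Some). Qed.

(* A projection of trace [c] acting on span {1, P - c}: the stack symbol [None]
   stands for the centered element [P - c], and
   [(P - c) P = (1 - c) (c + (P - c))]. *)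
Definition proj_op f s : C :=
  if s is None :: s' then (1 - c) * (c * f s' + f s) else c * f s + f (None :: s).

Definition compression_op (x : option B) :=
  if x is Some _ then read option_cumulant x else proj_op.

Lemma compression_op_linear : linear_op compression_op.
Proof.
move=> [b|] a f g s; first exact: read_linear.
by rewrite /= /proj_op; case: s => [|[b|] s]; ring.
Qed.

Lemma proj_op_id f s : ~~ top_colored isSome false s ->
  proj_op (proj_op f) s = proj_op f s /\
  proj_op (proj_op f) (None :: s) = proj_op f (None :: s).
Proof. by case: s => [|[b|] s] // _; rewrite /= /proj_op; split; ring. Qed.

Lemma eq_proj_op f g s : ~~ top_colored isSome false s ->
    f s = g s -> f (None :: s) = g (None :: s) ->
  proj_op f s = proj_op g s /\ proj_op f (None :: s) = proj_op g (None :: s).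
Proof. by case: s => [|[b|] s] // _ ef efN; rewrite /proj_op ef efN. Qed.

(** The word is a power of the idempotent P. The claim at [None :: s] is carried along because
    [proj_op f s] evaluates [f] there too. *)
Lemma run_proj u f s : ~~ nilp u -> colored isSome false u ->
    ~~ top_colored isSome false s ->
  run compression_op u f s = proj_op f s /\
  run compression_op u f (None :: s) = proj_op f (None :: s).
Proof.
move=> + + sS; elim: u => // -[//|] [//|x u] IH _ ui.
have [IH1 IH2] := IH isT ui.
have [<- <-] := proj_op_id f sS.
exact: (@eq_proj_op (run compression_op (x :: u) f)).
Qed.

Lemma option_cumulant_mixed w :
  has (fun x => isSome x == true) w -> has (fun x => isSome x != true) w ->
  option_cumulant w = 0.
Proof.
move=> _; rewrite (has_predC (fun x => isSome x == true)) => /negbTE.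
by rewrite /option_cumulant (eq_all (fun x => eqb_id _)) => ->.
Qed.

Lemma compression_op_free : free_op isSome compression_op.
Proof.
move=> [] u f s u0 ui f0 si.
  rewrite -[s]cat0s (run_read_block option_cumulant_mixed _ ui) //.
  by case.
have [-> _] := run_proj f u0 ui si.
have [-> _] := @run_proj u (@vacuum C _) [::] u0 ui isT.
by case: s si f0 => [|[b|] s] //= _ f0; rewrite /vacuum mulr1 addr0 [f (None :: _)]f0 ?addr0.
Qed.

(* [compress_stack t g] evaluates [g] on the stack where a [P = c + (P - c)] is
   inserted below every letter of [t]. *)
Fixpoint compress_stack t g : C :=
  if t is b :: t' then
    c * compress_stack t' (fun s => g (Some b :: s)) +
    compress_stack t' (fun s => g (Some b :: None :: s))
  else g [::].

(** This is [proj_op g s = g s] on the stacks that do not already have P - c on top. *)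
Definition proj_invariant g := forall s, ~~ top_colored isSome false s ->
  c * g s + g (None :: s) = g s.

Lemma proj_op_invariant f : proj_invariant (proj_op f).
Proof. by case=> [|[b|] s] // _; rewrite /proj_op; ring. Qed.

Lemma eq_compress_stack t f g :
  (forall s, ~~ top_colored isSome false s -> f s = g s) ->
  compress_stack t f = compress_stack t g.
Proof.
elim: t f g => [|b t IH] f g fg /=; first exact: fg.
by congr (_ * _ + _); apply: IH => s _; apply: fg.
Qed.

Lemma compress_stackD t f g :
  compress_stack t (fun s => f s + g s) =
  compress_stack t f + compress_stack t g.
Proof. by elim: t f g => //= x t IH f g; rewrite !IH; ring. Qed.

Lemma compress_stackZ t a f :
  compress_stack t (fun s => a * f s) = a * compress_stack t f.
Proof. by elim: t f => //= x t IH f; rewrite !IH; ring. Qed.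

Lemma compress_stack0 t f : (forall s, f s = 0) -> compress_stack t f = 0.
Proof.
elim: t f => [|b t IH] f f0 /=; first exact: f0.
by rewrite !IH // mulr0 addr0.
Qed.

Lemma compress_stack_invariant t g : proj_invariant g ->
  c * compress_stack t g + compress_stack t (fun s => g (None :: s)) =
  compress_stack t g.
Proof.
by move=> gP; rewrite -compress_stackZ -compress_stackD; apply: eq_compress_stack.
Qed.

Lemma pop_None g x ys s :
  pop option_cumulant g (map Some (x :: ys)) (None :: s) =
  kap (x :: ys) * g (None :: s).
Proof.
rewrite [LHS]/= -/(map Some (x :: ys)) option_cumulant_map.
by rewrite (pop_mixed option_cumulant_mixed) ?addr0.
Qed.

(** Below the open block lies P = c + (P - c). The summand P - c forces the block to close, which is
    the second term; the summand c pays for the gap when the block is extended. Once the block is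
    closed, invariance recombines both summands. *)
Lemma compress_stack_pop N t y ys g : proj_invariant g ->
  N * c ^+ size (y :: ys) *
    (c * compress_stack t (pop option_cumulant g (map Some (y :: ys))) +
     kap (y :: ys) * compress_stack t (fun s => g (None :: s))) =
  pop (scaled_cumulant kap c N) (fun t => compress_stack t g) (y :: ys) t.
Proof.
move=> gP; elim: t y ys => [|b t IH] y ys.
  have /= gE := compress_stack_invariant [::] gP.
  rewrite /= -/(map Some (y :: ys)) option_cumulant_map.
  by rewrite -[X in _ = _ * X + _]gE /scaled_cumulant /=; ring.
set ys' := y :: ys.
rewrite -[RHS]/(scaled_cumulant kap c N ys' * compress_stack (b :: t) g +
  pop (scaled_cumulant kap c N) (fun t => compress_stack t g) (b :: ys') t).
rewrite -IH -[in RHS](compress_stack_invariant (b :: t) gP) -/ys'.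
pose h := pop option_cumulant g (map Some ys').
pose h' := pop option_cumulant g (map Some (b :: ys')).
have hb s : h (Some b :: s) = kap ys' * g (Some b :: s) + h' s.
  by rewrite -option_cumulant_map.
have hbN s : h [:: Some b, None & s] =
    kap ys' * g [:: Some b, None & s] + kap (b :: ys') * g (None :: s).
  by rewrite hb /h' pop_None.
rewrite -/h -/h'.
rewrite ![compress_stack (b :: t) _]/= (funext hb) (funext hbN).
by rewrite !compress_stackD !compress_stackZ /scaled_cumulant [size (b :: _)]/= exprS; ring.
Qed.

(** The P read just before [b] becomes the one below [b] on the stack. A block starts with weight
    [N * c ^+ 1 = 1]. *)
Lemma compress_stack_op N t b g : N * c = 1 -> proj_invariant g ->
  compress_stack t (proj_op (read option_cumulant (Some b) g)) =
  read (scaled_cumulant kap c N) b (fun t => compress_stack t g) t.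
Proof.
move=> Nc gP; rewrite /read -compress_stack_pop //= expr1 Nc mul1r.
pose h := pop option_cumulant g (map Some [:: b]).
rewrite -/h (@eq_compress_stack _ _ (fun s =>
    c * (g (Some b :: s) + h s) +
    (g [:: Some b, None & s] + kap [:: b] * g (None :: s)))).
  by rewrite !(compress_stackD, compress_stackZ) /=; ring.
by move=> [|[b'|] s] // _; rewrite -pop_None.
Qed.

(** The extra factor [c] is the trace of the final P. *)
Lemma compress_stack_run N t (w : seq B) : N * c = 1 ->
  compress_stack t (run (fun b f => proj_op (compression_op (Some b) f)) w
                      (proj_op (@vacuum C _))) =
  c * run (read (scaled_cumulant kap c N)) w (@vacuum C _) t.
Proof.
move=> Nc; elim: w t => [|b w IH] t /=.
  case: t => [|b t] /=; first by rewrite /proj_op /vacuum addr0.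
  by rewrite !compress_stack0 /vacuum ?mulr0 ?addr0 // => s;
    rewrite /proj_op /= mulr0 addr0.
rewrite (compress_stack_op _ _ Nc); last first.
  by case: w {IH} => [|b' w] /=; exact: proj_op_invariant.
by rewrite -readZ; congr read; apply/funext.
Qed.

End CompressionModel.

(** * Words in a tracial space and star-freeness *)

Section TracialMoments.
Variables (R : realType) (A : tracialSpace R).

Definition word_moment (L : Type) (ev : L -> A) (w : seq L) : R[i] :=
  tau A (\prod_(x <- w) ev x).

Lemma word_moment_map (L L' : Type) (h : L -> L') (ev : L' -> A) w :
  word_moment ev (map h w) = word_moment (ev \o h) w.
Proof. by rewrite /word_moment big_map. Qed.

Lemma star_algebra_gen_prod (S : set A) (L : Type) (ev : L -> A) w :
  (forall x, x \in map ev w -> star_algebra_gen S x) ->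
  star_algebra_gen S (\prod_(x <- w) ev x).
Proof.
move=> evS B [/[dup] subB [B1 _ BM _] SB]; elim: w evS => [|x w IH] evS.
  by rewrite big_nil.
rewrite big_cons; apply: BM; last by apply: IH => y yw; apply: evS; rewrite inE yw orbT.
by apply: (evS (ev x)) => //; rewrite inE eqxx.
Qed.

Lemma star_algebra_gen_centered (S : set A) a :
  star_algebra_gen S a -> star_algebra_gen S (a - (tau A a)%:A).
Proof.
move=> aS B [/[dup] subB [B1 BD _ _] SB].
by rewrite addrC -scaleNr; apply: BD => //; apply: aS.
Qed.

Lemma tau_centered a : tau A (a - (tau A a)%:A) = 0.
Proof. by rewrite linearB linearZ /= tau1 mulr1 subrr. Qed.

Section FreeWords.
Variables (I : eqType) (S : I -> set A) (L : Type) (col : L -> I) (ev : L -> A).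
Hypothesis evS : forall x, star_algebra_gen (S (col x)) (ev x).

Lemma centered_word_moment w us :
  centered (word_moment ev) w us =
  tau A (\prod_(x <- w) ev x *
         \prod_(u <- us) (\prod_(x <- u) ev x - (word_moment ev u)%:A)).
Proof.
elim: us w => [|u us IH] w /=; first by rewrite big_nil mulr1.
rewrite !IH big_cons mulrBl mulrBr linearB big_cat /= mulrA; congr (_ - _).
by rewrite -scalerAl mul1r -scalerAr linearZ.
Qed.

Lemma star_free_moments : star_free S -> free_moments col (word_moment ev).
Proof.
move=> Sfree b bs; set bs' := b :: bs => /andP[bsP bsS].
rewrite centered_word_moment big_nil mul1r big_map.
rewrite (big_nth b) big_mkord.
apply: (Sfree _ (fun j => (nth b bs' j).1)
  (fun j => \prod_(x <- (nth b bs' j).2) ev x - (word_moment ev (nth b bs' j).2)%:A)) => //.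
  move=> j lt_j; split; last exact: tau_centered.
  apply: star_algebra_gen_centered; have /andP[_] := all_nthP b bsP j lt_j.
  case: (nth b bs' j) => i u /= ui; apply: star_algebra_gen_prod.
  elim: u ui => //= x u IH /andP[/eqP xi ui] y; rewrite inE => /predU1P[->|].
    by rewrite -xi.
  exact: IH.
move=> j lt_j; apply/eqP.
by have /(sortedP b)/(_ _ lt_j) := bsS.
Qed.

End FreeWords.

Lemma adj_ifP (S : set A) b a : S a -> star_algebra_gen S (adj_if b a).
Proof.
by move=> Sa B [[_ _ _ BV] SB]; case: b => /=; [apply: BV|]; apply: SB.
Qed.

Lemma star_sum (J : finType) (f : J -> A) : star (\sum_j f j) = \sum_j star (f j).
Proof.
have star0 : star (0 : A) = 0 by rewrite -(scale0r 0) starZ rmorph0 !scale0r.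
by rewrite (big_morph _ (@starD R A) star0).
Qed.

End TracialMoments.

(** * Star-moments of the compression *)

Section Compression.
Variables (R : realType) (A : tracialSpace R) (a P : A) (c : R[i]).
Variables (kap : seq bool -> R[i]).
Hypothesis kapP : forall w, run (read kap) w (@vacuum _ bool) [::] =
  word_moment (fun b => adj_if b a) w.
Hypothesis (Psa : star P = P) (Pproj : P * P = P) (tauP : tau A P = c).
Variables (S : bool -> set A) (Sfree : star_free S).
Hypothesis (Sa : S true a) (SP : S false P).

Definition compression_letter (x : option bool) := if x is Some b then adj_if b a else P.

(** Both sides are free for the coloring [isSome], so it suffices to compare words in [a] alone,
    given by [kapP], and words in P alone, where P is idempotent. *)
Lemma compression_moment w :
  word_moment compression_letter w =
  run (compression_op kap c) w (@vacuum _ _) [::].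
Proof.
have evS x : star_algebra_gen (S (isSome x)) (compression_letter x).
  by case: x => [b|]; [exact: adj_ifP|exact: (@adj_ifP _ _ _ false)].
move: w; apply: (free_moments_unique (col := isSome)).
- exact: star_free_moments evS Sfree.
- exact: free_op_moments (compression_op_linear kap c) (compression_op_free kap c).
- by rewrite /word_moment big_nil tau1.
case=> w wi.
  have -> : w = map Some (pmap id w).
    by elim: w wi => //= -[b|] // w IH /= /IH {1}->.
  rewrite word_moment_map -[[::] in RHS]/(map Some [::]).
  rewrite (run_map (kap := kap) (kap' := option_cumulant kap)) ?kapP //.
  exact: option_cumulant_map.
have [w0|w0] := boolP (nilp w).
  by case: w w0 {wi} => // _; rewrite /word_moment big_nil tau1.
have [-> _] := @run_proj _ _ kap c w (@vacuum _ _) [::] w0 wi isT.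
rewrite /proj_op /vacuum /= mulr1 addr0 -tauP; congr (tau A _).
elim: w w0 wi => // -[//|] [|x w] IH _ wi; first by rewrite big_cons big_nil mulr1.
by rewrite big_cons IH //= Pproj.
Qed.

Lemma compression_distribution N w : N * c = 1 ->
  star_distribution P (fun x => N * tau A x) (P * a * P) w =
  run (read (scaled_cumulant kap c N)) w (@vacuum _ _) [::].
Proof.
(* Adjacent projections merge, so the word becomes P a P a ... a P, with [None] for P; the empty
   word gives the unit P. *)
move=> Nc; pose pw := foldr (fun b v => None :: Some b :: v) [:: None] w.
have -> : star_distribution P (fun x => N * tau A x) (P * a * P) w =
    N * word_moment compression_letter pw.
  congr (N * tau A _); rewrite {}/pw; elim: w => [|b w IH] /=.
    by rewrite big_cons big_nil mulr1.
  rewrite !big_cons /= {}IH.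
  have -> : adj_if b (P * a * P) = P * adj_if b a * P.
    by case: b => //=; rewrite !starM Psa mulrA.
  rewrite -!mulrA; congr (_ * (_ * _)).
  by case: w => [|b' w] /=; rewrite !big_cons ?mulrA /= ?mulrA Pproj.
rewrite compression_moment.
have -> : run (compression_op kap c) pw (@vacuum _ _) [::] =
    compress_stack c [::] (run (fun b f => proj_op c (compression_op kap c (Some b) f)) w
                      (proj_op c (@vacuum _ _))).
  by rewrite /=; congr (_ [::]); rewrite /pw; elim: (w) => //= b v ->.
by rewrite (compress_stack_run _ _ _ Nc) mulrA Nc mul1r.
Qed.

End Compression.

(** * Star-moments of a scaled sum of free copies *)

Section FreeSum.
Variables (R : realType) (A : tracialSpace R) (J : finType) (a : J -> A) (c : R[i]).
Variables (kap : seq bool -> R[i]).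
Hypothesis kapP : forall j w, run (read kap) w (@vacuum _ bool) [::] =
  word_moment (fun b => adj_if b (a j)) w.
Variables (S : J -> set A) (Sfree : star_free S) (Sa : forall j, S j (a j)).

Definition sum_letter (x : J * bool) := adj_if x.2 (a x.1).

Lemma sum_moment w :
  word_moment sum_letter w = run (read (joint_cumulant kap)) w (@vacuum _ _) [::].
Proof.
have evS x : star_algebra_gen (S x.1) (sum_letter x) by exact: adj_ifP.
move: w; apply: (free_moments_unique (col := fst)).
- exact: star_free_moments evS Sfree.
- apply: free_op_moments => [x b f g s|]; first exact: read_linear.
  move=> i u f s u0 ui f0 si; rewrite -[s]cat0s.
  by rewrite (run_read_block (@joint_cumulant_mixed _ _ _ kap i) _ ui).
- by rewrite /word_moment big_nil tau1.
move=> i w wi; have -> : w = map (pair i) (map snd w).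
  by elim: w wi => //= -[j b] w IH /= /andP[/eqP-> /IH {1}->].
rewrite word_moment_map -[[::] in RHS]/(map (pair i) [::]).
rewrite (run_map (kap := kap) (kap' := joint_cumulant kap)) ?(kapP i) //.
exact: joint_cumulant_pair.
Qed.

Lemma sum_distribution w : c^* = c ->
  star_distribution 1 (tau A) (c *: \sum_j a j) w =
  run (read (scaled_cumulant kap c #|J|%:R)) w (@vacuum _ _) [::].
Proof.
move=> cr; rewrite -sum_stack_run /=.
have adjE b : adj_if b (c *: \sum_j a j) = c *: \sum_j sum_letter (j, b).
  by case: b; rewrite //= starZ star_sum cr.
(* The word [v] collects the factors whose color has already been chosen. *)
suff E v : tau A (\prod_(x <- v) sum_letter x *
     foldr (fun b y => adj_if b (c *: \sum_j a j) * y) 1 w) =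
   run (read (joint_cumulant kap)) v (run (sum_op kap c) w (@vacuum _ _)) [::].
  by have := E [::]; rewrite big_nil mul1r.
elim: w v => [|b w IH] v /=; first by rewrite mulr1 -sum_moment.
rewrite run_sum; last by move=> x *; exact: read_linear.
rewrite adjE -scalerAl -scalerAr linearZ /=; congr (_ * _).
rewrite mulr_suml mulr_sumr linear_sum; apply: eq_bigr => j _.
have := IH (v ++ [:: (j, b)]).
by rewrite run_cat big_cat big_seq1 /= mulrA.
Qed.

End FreeSum.

Theorem proposition1 (R : realType) (A : tracialSpace R)
    (X U : R -> A) (hU : free_unitary_brownian_motion X U)
    (k : nat) (hk : (2 <= k)%N)
    (V : 'I_k -> R -> A)
    (hVcopy : forall j, process_copy U (V j))
    (hVfree : star_free (fun j => process_set (V j)))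
    (P : A) (hPsa : star P = P) (hPproj : P * P = P)
    (hPtau : tau A P = k%:R^-1)
    (hPfree : star_free2 [set P] (process_set U))
    (t : R) (ht : 0 <= t) :
  star_distribution P (fun a => k%:R * tau A a) (P * U t * P)
  =1 star_distribution 1 (tau A) (k%:R^-1 *: \sum_(j < k) V j t).
Proof.
have [|kap kapU] := @cumulant_exists _ _ (word_moment (fun b => adj_if b (U t))).
  by rewrite /word_moment big_nil tau1.
have kapV j w : run (read kap) w (@vacuum _ _) [::] =
    word_moment (fun b => adj_if b (V j t)) w.
  (* Apply the equality of process moments to words whose times all equal [t]. *)
  rewrite kapU; have := hVcopy j (map (pair t) w).
  rewrite /process_moment !big_map => /(_ _)/esym; apply=> l.
  by elim: w => //= b w IH; rewrite inE => /predU1P[->|/IH].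
have Nc : k%:R * k%:R^-1 = 1 :> R[i].
  by rewrite mulfV // pnatr_eq0 -lt0n (leq_trans _ hk).
(* The coloring [isSome] puts the letters of U at [true], whereas [hPfree] has P there. *)
have free_swap : star_free (fun b : bool => if b then process_set U else [set P]).
  move=> n i a n0 aS ii; apply: (hPfree n (fun j => ~~ i j) a n0).
    by move=> j /aS; rewrite if_neg.
  by move=> j /ii ne /negb_inj.
move=> w; rewrite (compression_distribution kapU hPsa hPproj hPtau free_swap) //; last by exists t.
rewrite (sum_distribution kapV hVfree) ?card_ord //.
  by move=> j; exists t.
by rewrite fmorphV rmorph_nat.
Qed.
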